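(* Consider a packing mixed integer linear program $(\mathrm{P})$. Let $\mathcal{J}\subseteq2^{[n]}$ be a partition of the index set of columns of $A$ and let $G^{\mathrm{pack}}_{A,\mathcal{J}}$ be the packing interaction graph of $A$. Suppose $G^{\mathrm{pack}}_{A,\mathcal{J}}$ is a tree and let $\Delta\geq 1$ be its maximum degree. Then $$z^{N.S.}\le\left(\frac{2\Delta-1}{\Delta}\right)z^I .$$
   Context: $[n]=\{1,\dots,n\}$. The packing problem $(\mathrm{P})$ is: maximize $c^Tx$ subject to $Ax\le b$, $x_j\in\mathbb{Z}_+$ for $j\in\mathcal{L}$, $x_j\in\mathbb{R}_+$ for $j\in[n]\setminus\mathcal{L}$, where $A\in\mathbb{Q}_+^{m\times n}$, $b\in\mathbb{Q}_+^m$, $c\in\mathbb{Q}_+^n$, $\mathcal{L}\subseteq[n]$. Let $P$ be its feasible region, $P^I$ the convex hull of $P$, and $P^{LP}$ the feasible region of its linear programming relaxation; $z^I=\max\{c^Tx:x\in P^I\}$. Sparse closures: for $N\subseteq[n]$, a sparse cut on $N$ is an inequality $\alpha^Tx\le\beta$ valid for $P^I$ with $\alpha_i=0$ for all $i\notin N$; $P^{(N)}$ is the set of points of $P^{LP}$ satisfying all sparse cuts on $N$. For a partition $\mathcal{J}=\{J_1,\dots,J_q\}$ of $[n]$, the packing interaction graph $G^{\mathrm{pack}}_{A,\mathcal{J}}$ has one node $v_j$ for each block $J_j$, and distinct nodes $v_i,v_j$ are adjacent iff some row of $A$ has a nonzero entry in a column of $J_i$ and a nonzero entry in a column of $J_j$.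 Natural sparse closure: for each row $i\in[m]$ let $N_i$ be the union of those blocks $J_u$ for which row $i$ of $A$ has a nonzero entry in some column of $J_u$. Then $P^{N.S.}:=\bigcap_{i=1}^mP^{(N_i)}$ and $z^{N.S.}:=\max\{c^Tx:x\in P^{N.S.}\}$. *)

(* Defs.v *)
From mathcomp Require Import all_boot all_order all_algebra.
From mathcomp Require Import all_classical all_reals all_analysis.

Set Implicit Arguments.
Unset Strict Implicit.
Unset Printing Implicit Defensive.

Import Order.TTheory GRing.Theory Num.Theory.

Local Open Scope classical_set_scope.
Local Open Scope ring_scope.

Section FiniteGraphs.
Variables (T : finType) (e : rel T).

Definition simple_graph : Prop := symmetric e /\ irreflexive e.

Definition graph_connected : Prop :=
  (0 < #|T|)%N /\ forall x y : T, connect e x y.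

(* A [ucycle] is a closed walk with distinct vertices, given by its list of
   vertices; an edge walked back and forth counts as one of size 2. *)
Definition graph_acyclic : Prop :=
  forall s : seq T, ucycle e s -> (size s <= 2)%N.

Definition is_tree : Prop :=
  [/\ simple_graph, graph_connected & graph_acyclic].

Definition max_degree : nat := (\max_(x : T) #|[set y : T | e x y]%SET|)%N.

End FiniteGraphs.

Section Packing.
Variables (m n : nat) (A : 'M[rat]_(m, n)).

(* Row [i] has a nonzero entry in a column of [B]. *)
Definition row_meets (i : 'I_m) (B : {set 'I_n}) : bool :=
  [exists j in B, A i j != 0].

Definition block (J : {set {set 'I_n}}) : finType := {B : {set 'I_n} | B \in J}.

Definition pack_adj (J : {set {set 'I_n}}) : rel (block J) :=
  fun u v => (u != v) &&
    [exists i : 'I_m, row_meets i (val u) && row_meets i (val v)].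

Definition natural_support (J : {set {set 'I_n}}) (i : 'I_m) : {set 'I_n} :=
  (\bigcup_(B in J | row_meets i B) B)%SET.

End Packing.

Arguments pack_adj {m n} A J u v.

Section Closures.
Variables (R : realType) (m n : nat).
Variables (A : 'M[rat]_(m, n)) (b : 'cV[rat]_m) (L : {set 'I_n}).

Definition dotv (u x : 'cV[R]_n) : R := \sum_(j < n) u j 0 * x j 0.

Definition lp_region : set 'cV[R]_n :=
  [set x | (forall i, \sum_(j < n) ratr (A i j) * x j 0 <= ratr (b i 0)) /\
           (forall j, 0 <= x j 0)].

Definition feasible : set 'cV[R]_n :=
  [set x | (forall i, \sum_(j < n) ratr (A i j) * x j 0 <= ratr (b i 0)) /\
           forall j, if j \in L then x j 0 \is a Num.nat else 0 <= x j 0].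

Definition convex_hull (S : set 'cV[R]_n) : set 'cV[R]_n :=
  smallest (@convex_set R (convex_lmodType 'cV[R]_n)) S.

Definition integer_hull : set 'cV[R]_n := convex_hull feasible.

(* [dotv alpha x <= beta] is a sparse cut on [N]. *)
Definition sparse_cut (N : {set 'I_n}) (alpha : 'cV[R]_n) (beta : R) : Prop :=
  (forall x, integer_hull x -> dotv alpha x <= beta) /\
  (forall j, j \notin N -> alpha j 0 = 0).

Definition sparse_closure (N : {set 'I_n}) : set 'cV[R]_n :=
  [set x | lp_region x /\
           forall alpha beta, sparse_cut N alpha beta -> dotv alpha x <= beta].

Definition natural_sparse_closure (J : {set {set 'I_n}}) : set 'cV[R]_n :=
  \bigcap_(i in [set: 'I_m]) sparse_closure (natural_support A J i).

(* The supremum in [\bar R]: it is the maximum whenever the latter exists,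
   and [+oo] when the objective is unbounded. *)
Definition opt_value (c : 'cV[rat]_n) (S : set 'cV[R]_n) : \bar R :=
  ereal_sup [set (dotv (map_mx ratr c) x)%:E | x in S].

End Closures.

Arguments integer_hull R {m n} A b L _.
Arguments natural_sparse_closure R {m n} A b L J _.

(* Main.v *)
(* Give every vertex of the tree Delta of 2 * Delta - 1 colours so that the
   vertices of each colour induce a subgraph of maximum degree at most 1.  Its
   components, isolated vertices and edges, each lie in the support of some row
   and no row meets two of them.  So for x in the natural sparse closure the
   sparse cuts given by the restrictions of c, together with the gluing of
   near-optimal feasible points of the components, bound the part of c^T x
   carried by one colour by z^I.  Summing over the colours counts c^T x exactly
   Delta times. *)

Require Import Defs.
From mathcomp Require Import all_boot all_order all_algebra.
From mathcomp Require Import all_classical all_reals all_analysis.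
From mathcomp Require Import zify lra.

Import Order.TTheory GRing.Theory Num.Theory.

Local Open Scope ring_scope.

(** * Assigning sets of colours to the vertices of a tree *)

Section TreeColouring.
Variables (T : finType) (e : rel T) (d : nat).
Hypotheses (e_tree : is_tree e).
Hypothesis deg_e : forall x, (#|[set y | e x y]%SET| <= d.+1)%N.

Local Notation within W := [rel x y | [&& e x y, x \in W & y \in W]].

(** Two different neighbours of [u] in [W], joined by a simple path inside [W], would close up with
    [u] to a cycle on at least three vertices. *)
Lemma tree_exit_unique (W : {set T}) (u w w' : T) :
    (forall x y, x \in W -> y \in W -> connect (within W) x y) ->
  u \notin W -> w \in W -> w' \in W -> e u w -> e u w' -> w' = w.
Proof.
case: e_tree => -[e_sym _] _ acyc conW uW wW w'W euw euw'.
have /connectP[p0 pth last_p] := conW _ _ wW w'W.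
case/shortenP: pth last_p => p pth uniqp _ last_p.
apply/eqP/contraT => /eqP nww'.
have pW : {subset p <= W}.
  elim: p w {wW euw last_p nww' uniqp} pth => [|y p IH] w //= /andP[/and3P[_ _ yW] pp] z.
  by rewrite inE => /predU1P[->//|]; apply: IH pp z.
have pe : path e w p by apply: sub_path pth => x y /and3P[].
have neq_u x : x \in W -> (u == x) = false by apply: contraTF => /eqP <-.
have := acyc (u :: w :: p).
rewrite /ucycle /= rcons_path euw pe -last_p e_sym euw' /= inE neq_u //=.
rewrite (contra (@pW u)) // => /(_ uniqp) {pth uniqp pe pW}.
by case: p last_p.
Qed.

(* Colour the tree one vertex at a time: a new vertex u attached to w receives
   a colour of w that no coloured neighbour of w has, together with all the
   colours w lacks, so that adjacent vertices share exactly one colour. *)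
Lemma tree_colouring : exists S : T -> {set 'I_(2 * d.+1 - 1)},
  (forall v, #|S v| = d.+1) /\
  (forall k v a b, k \in S v -> k \in S a -> k \in S b ->
     e v a -> e v b -> a = b).
Proof.
case: (e_tree) => -[e_sym e_irr] [T_gt0 conn] _.
(* The induction carries two extra invariants: [W] stays connected, so that a new vertex has a
   single neighbour in it, and adjacent vertices share at most one colour, so that this neighbour
   has a colour to spare. *)
suff colour N : (N <= #|T|)%N -> exists (W : {set T}) S, (N <= #|W|)%N /\
    (forall x y, x \in W -> y \in W -> connect (within W) x y) /\
    (forall v, v \in W -> #|S v : {set 'I_(2 * d.+1 - 1)}| = d.+1) /\
    (forall v a, v \in W -> a \in W -> e v a -> (#|S v :&: S a|%SET <= 1)%N) /\
    (forall k v a b, v \in W -> a \in W -> b \in W ->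
       k \in S v -> k \in S a -> k \in S b -> e v a -> e v b -> a = b).
  have [W [S [cardW [_ [cS [_ uS]]]]]] := colour _ (leqnn _).
  have inW x : x \in W.
    have /eqP -> : W == [set: T]%SET by rewrite eqEcard finset.subsetT cardsT.
    by rewrite inE.
  by exists S; split=> [v|k v a b kv ka kb]; [apply: cS | apply: (uS k)].
elim: N => [|N IH] leN.
  exists finset.set0, (fun=> finset.set0); do ![split] => //; by move=> ?; rewrite inE.
have [W [S [cardW [conW [cS [cI uS]]]]]] := IH (ltnW leN).
have [ltW|geW] := ltnP N #|W|.
  by exists W, S.
have [W0|[r rW]] := finset.set_0Vmem W.
  have /card_gt0P[r _] := T_gt0.
  have [K cK] : exists K : {set 'I_(2 * d.+1 - 1)}, #|K| = d.+1.
    have : (d.+1 <= #|'I_(2 * d.+1 - 1)|)%N by rewrite card_ord; lia.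
    rewrite -cardsT => /card_geqP[s [us ss _]]; exists [set x in s]%SET.
    by rewrite cardsE (card_uniqP us).
  exists [set r]%SET, (fun=> K); rewrite cards1 W0 cards0 in cardW *.
  split; first by lia.
  split; first by move=> x y /set1P-> /set1P->.
  split=> //; split.
    by move=> v a /set1P-> /set1P->; rewrite e_irr.
  by move=> k v a b _ /set1P-> /set1P->.
have [u0 u0W] : exists u0, u0 \notin W.
  apply/existsP; apply: contraTT geW => /existsPn WT; rewrite -ltnNge.
  rewrite (leq_trans leN) // -cardsT subset_leq_card //.
  by apply/fintype.subsetP => x _; exact/negPn/WT.
have [w [u [wW uW ewu]]] : exists w u, [/\ w \in W, u \notin W & e w u].
  have /connectP[p pth lastp] := conn r u0.
  elim: p r rW pth lastp => [|y p IHp] r rW /=.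
    by move=> _ E; rewrite E rW in u0W.
  case/andP=> ery pth lastp.
  have [yW|yW] := boolP (y \in W); first exact: IHp yW pth lastp.
  by exists r, y.
have euw : e u w by rewrite e_sym.
have uniq_w x : x \in W -> e u x -> x = w.
  by move=> xW eux; apply: (tree_exit_unique _ _ _ _ conW uW wW xW euw eux).
pose NW := [set a in W | e w a]%SET.
(* The uncoloured neighbour [u] takes one of the at most [d.+1] places around [w]. *)
have cardNW : (#|NW| <= d)%N.
  have : NW \proper [set y | e w y]%SET.
    apply/fintype.properP; split.
      by apply/fintype.subsetP => x; rewrite !inE => /andP[].
    by exists u; rewrite !inE // (negPf uW).
  by move/proper_card => lt; rewrite -ltnS (leq_trans lt).
(* Of the [d.+1] colours of [w], each of its at most [d] coloured neighbours uses at most one. *)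
have [k kw kN] : exists2 k, k \in S w &
    forall a, a \in W -> e w a -> k \notin S a.
  pose U := (\bigcup_(a in NW) (S w :&: S a))%SET.
  have cU : (#|U| <= d)%N.
    apply: leq_trans cardNW; rewrite -[#|NW|]sum1_card.
    apply: leq_trans (_ : (\sum_(a in NW) #|S w :&: S a|%SET <= _)%N).
      rewrite /U; elim/big_ind2: _ => [|X x Y y le1 le2|//]; first by rewrite cards0.
      by rewrite (leq_trans (leq_card_setU _ _)) // leq_add.
    by apply: leq_sum => a; rewrite inE => /andP[aW ewa]; apply: cI.
  have /fintype.subsetPn[k kw kU] : ~~ (S w \subset U).
    by apply/negP => /subset_leq_card; rewrite cS // leqNgt ltnS cU.
  exists k => // a aW ewa; apply: contra kU => ka; apply/finset.bigcupP; exists a.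
    by rewrite inE aW.
  by rewrite inE kw.
(* Out of [2 * d.+1 - 1] colours [w] lacks exactly [d], so adding [k] gives [d.+1]. *)
pose Su := (k |: ~: S w)%SET.
have cSu : #|Su| = d.+1.
  rewrite cardsU1 !inE kw /= cardsCs finset.setCK card_ord cS //; lia.
have Sw_Su j : j \in S w -> j \in Su -> j = k.
  by move=> jw; rewrite !inE jw orbF => /eqP.
have nu x : x \in W -> (x == u) = false.
  by move=> xW; apply/negP => /eqP E; rewrite -E xW in uW.
exists (u |: W)%SET, (fun x => if x == u then Su else S x).
split; first by rewrite cardsU1 uW.
have sub x y : connect (within W) x y -> connect (within (u |: W)%SET) x y.
  apply: connect_sub => a b /and3P[eab aW bW].
  by apply: connect1; rewrite /= eab !inE aW bW !orbT.
have wu : connect (within (u |: W)%SET) w u.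
  by apply: connect1; rewrite /= ewu !inE eqxx wW !orbT.
have uw : connect (within (u |: W)%SET) u w.
  by apply: connect1; rewrite /= euw !inE eqxx wW !orbT.
split.
  move=> x y /setU1P[->|xW] /setU1P[->|yW] //.
  - by apply: connect_trans uw (sub _ _ _); apply: conW.
  - by apply: connect_trans (sub _ _ _) wu; apply: conW.
  - by apply: sub; apply: conW.
split; first by move=> v /setU1P[->|vW]; rewrite ?eqxx // nu // cS.
have cwu : (#|S w :&: Su|%SET <= 1)%N.
  apply: (@leq_trans #|[set k]%SET|); last by rewrite cards1.
  apply: subset_leq_card; apply/fintype.subsetP => j; rewrite finset.in_setI finset.in_set1.
  by case/andP => jw ju; apply/eqP; apply: Sw_Su.
split.
  move=> v a /setU1P[->|vW] /setU1P[->|aW]; rewrite ?e_irr ?eqxx ?nu //.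
  - by move=> /(uniq_w _ aW)->; rewrite finset.setIC.
  - by rewrite e_sym => /(uniq_w _ vW)->.
  - exact: cI.
(* If [v] is the new vertex, both neighbours are [w]. If exactly one of [a] and [b] is new, then [v]
   is [w] and the colour is [k], which no neighbour of [w] in [W] has. *)
move=> j v a b /setU1P[->|vW] /setU1P[->|aW] /setU1P[->|bW];
  rewrite ?e_irr ?eqxx ?nu //.
- by move=> _ _ _ /(uniq_w _ aW)-> /(uniq_w _ bW)->.
- move=> jv ju jb evu evb; rewrite e_sym in evu; have E := uniq_w v vW evu.
  rewrite E in jv evb.
  by rewrite (Sw_Su j) // (negPf (kN _ bW evb)) in jb.
- move=> jv ja ju eva evu; rewrite e_sym in evu; have E := uniq_w v vW evu.
  rewrite E in jv eva.
  by rewrite (Sw_Su j) // (negPf (kN _ aW eva)) in ja.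
- exact: uS.
Qed.

End TreeColouring.

(** * Feasible points, sparse cuts and gluing *)

Section PackingHull.
Variables (R : realType) (m n : nat).
Variables (A : 'M[rat]_(m, n)) (b : 'cV[rat]_m) (L : {set 'I_n}).
Implicit Types (x y alpha : 'cV[R]_n) (N : {set 'I_n}).

(** A half-space is convex, so it contains the hull as soon as it contains the feasible points. *)
Lemma dotv_integer_hull_le alpha (beta : R) :
    (forall y, feasible A b L y -> dotv alpha y <= beta) ->
  forall y, integer_hull R A b L y -> dotv alpha y <= beta.
Proof.
move=> ub; apply: (@smallest_sub _ _ _ [set y | dotv alpha y <= beta]%classic) => //.
move=> x y l /set_mem /= ax /set_mem /= ay; apply/mem_set => /=.
change (dotv alpha (l%:num *: x + (1 - l%:num) *: y) <= beta).
have -> : dotv alpha (l%:num *: x + (1 - l%:num) *: y) =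
    l%:num * dotv alpha x + (1 - l%:num) * dotv alpha y.
  rewrite /dotv !mulr_sumr -big_split; apply: eq_bigr => j _.
  by rewrite !mxE /= mulrDr !(mulrCA (alpha j 0)).
have -> : beta = l%:num * beta + (1 - l%:num) * beta.
  by rewrite -mulrDl addrCA subrr addr0 mul1r.
by rewrite lerD // ler_wpM2l // subr_ge0.
Qed.

Lemma feasible_ge0 x j : feasible A b L x -> 0 <= x j 0.
Proof. by case=> _ /(_ j); case: ifP => // _; apply: natr_ge0. Qed.

Hypotheses (A_ge0 : forall i j, 0 <= A i j) (b_ge0 : forall i, 0 <= b i 0).

Lemma feasible0 : feasible A b L (0 : 'cV[R]_n).
Proof.
split=> [i|j].
  by rewrite big1 ?ler0q // => j _; rewrite mxE mulr0.
by rewrite mxE; case: ifP => // _; rewrite rpred0.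
Qed.

(** If all feasible points stayed at least [eps] below [dotv alpha x], then [dotv alpha x - eps]
    would be the right-hand side of a sparse cut violated by [x]. The slack [eps] avoids any appeal
    to an attained maximum. *)
Lemma sparse_closure_approx N alpha x (eps : R) :
    sparse_closure A b L N x -> (forall j, j \notin N -> alpha j 0 = 0) ->
  0 < eps -> exists2 y, feasible A b L y & dotv alpha x < dotv alpha y + eps.
Proof.
move=> [_ cutx] alphaN eps_gt0; apply: contrapT => noy.
suff : dotv alpha x <= dotv alpha x - eps by lra.
apply: cutx; split=> //; apply: dotv_integer_hull_le => y fy.
by rewrite leNgt; apply/negP => lt; apply: noy; exists y => //; rewrite -ltrBlDr.
Qed.

(* The labels split the columns of [M] into classes no two of which share a
   row, so that near-optimal points of the classes glue to a feasible point. *)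
Lemma packing_glue (K : finType) (g : 'I_n -> K) (M : {set 'I_n})
    (c x : 'cV[R]_n) (r : R) :
    (forall i j j', j \in M -> j' \in M -> A i j != 0 -> A i j' != 0 ->
       g j = g j') ->
    (forall j, j \in M -> exists2 N, sparse_closure A b L N x &
       forall j', j' \in M -> g j' = g j -> j' \in N) ->
    (forall y, feasible A b L y -> dotv c y <= r) ->
  \sum_(j in M) c j 0 * x j 0 <= r.
Proof.
move=> rowM sparseM ub; apply/ler_addgt0Pr => eps eps_gt0.
pose cls k : 'cV[R]_n := \col_j (if (j \in M) && (g j == k) then c j 0 else 0).
have dotv_cls k y : dotv (cls k) y = \sum_(j in M | g j == k) c j 0 * y j 0.
  rewrite /dotv [RHS]big_mkcond; apply: eq_bigr => j _; rewrite mxE.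
  by case: ifP => // _; rewrite mul0r.
(* Each label may lose [del]; the successor in the denominator covers an empty [K]. *)
have [del del_gt0 le_eps] : exists2 del : R, 0 < del & del * #|K|%:R <= eps.
  exists (eps / #|K|.+1%:R); first by rewrite divr_gt0 // ltr0n.
  by rewrite -mulrA ler_piMr ?(ltW eps_gt0) // [_^-1 * _]mulrC ler_pdivrMr ?ltr0n //
    mul1r ler_nat leqnSn.
have /choice[Y YP] k : exists y,
    feasible A b L y /\ dotv (cls k) x <= dotv (cls k) y + del.
  have [/existsP[j /andP[jM /eqP <-]]|nok] :=
    boolP [exists j, (j \in M) && (g j == k)].
    have [N clN subN] := sparseM j jM.
    have [j' j'N|y fy /ltW le] :=
        sparse_closure_approx N (cls (g j)) x del clN _ del_gt0.
      rewrite mxE; case: ifP => // /andP[j'M /eqP E].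
      by rewrite subN in j'N.
    by exists y.
  (* A label without columns in [M] has zero objective, so the origin serves. *)
  exists 0; split; first exact: feasible0.
  have no j : (j \in M) && (g j == k) = false.
    by apply/negP => jk; case/negP: nok; apply/existsP; exists j.
  by rewrite !dotv_cls !big_pred0 // add0r ltW.
pose y : 'cV[R]_n := \col_j (if j \in M then Y (g j) j 0 else 0).
have yE j : j \in M -> y j 0 = Y (g j) j 0 by move=> jM; rewrite mxE jM.
have fy : feasible A b L y.
  split=> [i|j]; last first.
    rewrite mxE; case: (j \in M); first by have [[_ /(_ j)]] := YP (g j).
    by case: ifP => // _; rewrite rpred0.
  (* All columns of [M] met by row [i] carry the label of [j0], so the row sum of [y] is at most
     that of [Y (g j0)], whose entries outside [M] are nonnegative. *)
  have [/existsP[j0 /andP[j0M Aij0]]|noj] :=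
    boolP [exists j, (j \in M) && (A i j != 0)].
    have [[/(_ i) le_b _] _] := YP (g j0); apply: le_trans le_b.
    apply: ler_sum => j _; rewrite mxE; have [-> |Aij] := eqVneq (A i j) 0.
      by rewrite rmorph0 !mul0r.
    rewrite ler_wpM2l ?ler0q //; case: ifP => jM.
      by rewrite (rowM i j j0).
    by apply: feasible_ge0; have [] := YP (g j0).
  rewrite big1 ?ler0q // => j _; rewrite mxE; case: ifP => jM; last by rewrite mulr0.
  have [->|Aij] := eqVneq (A i j) 0; first by rewrite rmorph0 mul0r.
  by case/existsP: noj; exists j; rewrite jM.
have dotv_y : dotv c y = \sum_k dotv (cls k) (Y k).
  rewrite /dotv (bigID (mem M)) /= [X in _ + X]big1 ?addr0; last first.
    by move=> j /negPf jM; rewrite mxE jM mulr0.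
  rewrite (partition_big g xpredT) //; apply: eq_bigr => k _.
  by rewrite -/(dotv _ _) dotv_cls; apply: eq_bigr => j /andP[jM /eqP <-]; rewrite yE.
rewrite (partition_big g xpredT) //=.
apply: le_trans (_ : \sum_k (dotv (cls k) (Y k) + del) <= _).
  by apply: ler_sum => k _; rewrite -dotv_cls; have [] := YP k.
by rewrite big_split -dotv_y /= lerD ?ub // sumr_const -mulr_natr.
Qed.

End PackingHull.

(** * Colour classes of blocks against the natural sparse closure *)

Section NaturalSparseClosure.
Variables (R : realType) (m n : nat).
Variables (A : 'M[rat]_(m, n)) (b : 'cV[rat]_m) (L : {set 'I_n}).
Hypotheses (A_ge0 : forall i j, 0 <= A i j) (b_ge0 : forall i, 0 <= b i 0).
Variable J : {set {set 'I_n}}.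
Hypothesis J_cover : forall j, finset.pblock J j \in J.

Definition block_of (j : 'I_n) : block J := exist _ (finset.pblock J j) (J_cover j).

Hypothesis J_mem : forall j, j \in finset.pblock J j.

Local Notation e := (pack_adj A J).

Lemma pack_adj_block_of i j j' : A i j != 0 -> A i j' != 0 ->
  block_of j != block_of j' -> e (block_of j) (block_of j').
Proof.
move=> Aij Aij' neq; apply/andP; split=> //; apply/existsP; exists i.
by apply/andP; split; apply/existsP; [exists j | exists j']; rewrite J_mem.
Qed.

Lemma mem_natural_support i j :
  row_meets A i (val (block_of j)) -> j \in natural_support A J i.
Proof.
by move=> mi; apply/finset.bigcupP; exists (finset.pblock J j); rewrite ?J_mem ?J_cover.
Qed.

(* A vertex set inducing maximum degree at most 1 splits into isolated
   vertices and isolated edges, each inside some natural support. *)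
Lemma dissociation_le (M : {set block J}) (c x : 'cV[R]_n) (r : R) :
    symmetric e -> (forall v, exists u, e v u) ->
    {in M & &, forall v u w, e v u -> e v w -> u = w} ->
    natural_sparse_closure R A b L J x ->
    (forall y, feasible A b L y -> dotv c y <= r) ->
  \sum_(j | block_of j \in M) c j 0 * x j 0 <= r.
Proof.
move=> e_sym nbr degM xNS ub.
(* Since degrees inside [M] are at most 1, [comp v] is the whole component of [v] and can serve as
   its label. *)
pose comp v := [set u in M | (u == v) || e v u]%SET.
have compE v u : v \in M -> u \in M -> e v u -> comp v = [set v; u]%SET.
  move=> vM uM evu; apply/finset.setP => w; rewrite !inE.
  apply/andP/orP => [[wM /orP[->|evw]]|[/eqP->|/eqP->]]; rewrite ?eqxx ?evu ?orbT; auto.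
  by right; rewrite (degM v u w).
pose MC := [set j | block_of j \in M]%SET.
rewrite (eq_bigl (mem MC)); last by move=> j; rewrite /= inE.
apply: (packing_glue R m n A b L A_ge0 b_ge0 _ (comp \o block_of)) ub.
  move=> i j j'; rewrite !inE => jM j'M Aij Aij' /=.
  have [->//|neq] := eqVneq (block_of j) (block_of j').
  have ejj' := pack_adj_block_of i j j' Aij Aij' neq.
  by rewrite (compE _ _ jM j'M ejj') (compE _ _ j'M jM) 1?e_sym // finset.setUC.
move=> j; rewrite inE => jM.
(* A vertex isolated in [M] borrows a neighbour [u] outside [M], so in either case the row behind
   the edge has all of [comp] in its support. *)
have [u eju compu] : exists2 u, e (block_of j) u &
    comp (block_of j) \subset [set block_of j; u]%SET.
  have [/existsP[u /andP[uM eju]]|nou] :=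
    boolP [exists u, (u \in M) && e (block_of j) u].
    by exists u; rewrite ?(compE _ _ jM uM eju).
  have [u eju] := nbr (block_of j); exists u => //.
  apply/fintype.subsetP => w; rewrite !inE => /andP[wM /orP[->//|ejw]].
  by case/existsP: nou; exists w; rewrite wM.
have /andP[_ /existsP[i /andP[mj mu]]] := eju.
exists (natural_support A J i); first exact: xNS.
move=> j'; rewrite inE => j'M /= compj'; apply: mem_natural_support.
have : block_of j' \in comp (block_of j) by rewrite -compj' !inE j'M eqxx.
by move/(fintype.subsetP compu); rewrite !inE => /orP[]/eqP->.
Qed.

End NaturalSparseClosure.

(** * Summing the bounds over the colours *)

Theorem theorem14 (R : realType) (m n : nat)
    (A : 'M[rat]_(m, n)) (b : 'cV[rat]_m) (c : 'cV[rat]_n) (L : {set 'I_n})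
    (A_ge0 : forall i j, 0 <= A i j)
    (b_ge0 : forall i, 0 <= b i 0)
    (c_ge0 : forall j, 0 <= c j 0)
    (J : {set {set 'I_n}}) (J_partition : finset.partition J [set: 'I_n]%SET)
    (Delta : nat)
    (G_tree : is_tree (pack_adj A J))
    (Delta_max : max_degree (pack_adj A J) = Delta)
    (Delta_ge1 : (1 <= Delta)%N) :
  (opt_value c (natural_sparse_closure R A b L J) <=
     ((2 * Delta%:R - 1) / Delta%:R)%:E * opt_value c (integer_hull R A b L))%E.
Proof.
have /and3P[/eqP J_cov _ _] := J_partition.
have J_mem j : j \in finset.pblock J j by rewrite finset.mem_pblock J_cov inE.
have J_cover j : finset.pblock J j \in J by rewrite finset.pblock_mem // J_cov inE.
have [d dE] : exists d, Delta = d.+1 by exists Delta.-1; rewrite prednK.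
have deg v : (#|[set u | pack_adj A J v u]%SET| <= d.+1)%N.
  by rewrite -dE -Delta_max /max_degree (leq_bigmax v).
have [[e_sym e_irr] [_ conn] _] := G_tree.
(* A positive maximum degree yields one edge; connectedness then leaves no vertex isolated. *)
have nbr v : exists u, pack_adj A J v u.
  have [v0 [u0 ev0u0]] : exists v0 u0, pack_adj A J v0 u0.
    apply: contrapT => noe; move: Delta_ge1; rewrite -Delta_max /max_degree big1 // => w _.
    apply/eqP; rewrite cards_eq0; apply/eqP/finset.setP => u; rewrite !inE.
    by apply/negP => ewu; apply: noe; exists w, u.
  have [->|neq] := eqVneq v v0; first by exists u0.
  have /connectP[[|u p] /= pth lastp] := conn v v0; first by rewrite lastp eqxx in neq.
  by exists u; case/andP: pth.
have [S [cardS degS]] := tree_colouring _ _ d G_tree deg.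
have f0 := feasible0 R m n A b L b_ge0.
have sub_hull y : feasible A b L y -> integer_hull R A b L y.
  by apply: sub_gen_smallest.
pose cR : 'cV[R]_n := map_mx ratr c.
have ratio_gt0 : 0 < (2 * Delta%:R - 1) / Delta%:R :> R.
  rewrite dE divr_gt0 ?ltr0n // subr_gt0 -natrM ltr1n; lia.
have opt_ge y : feasible A b L y ->
    ((dotv cR y)%:E <= opt_value c (integer_hull R A b L))%E.
  by move=> fy; apply: ereal_sup_ubound; exists y => //; apply: sub_hull.
(* With a positive ratio the value [+oo] makes the bound trivial, and the feasible origin excludes
   [-oo]. *)
case zE : (opt_value c (integer_hull R A b L)) opt_ge => [r| |] opt_ge; last 2 first.
- by rewrite gt0_muley ?lte_fin // leey.
- by have := opt_ge _ f0.
apply: ge_ereal_sup => _ [x xNS <-]; rewrite -EFinM lee_fin -/cR.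
have ub y : feasible A b L y -> dotv cR y <= r by move/opt_ge; rewrite lee_fin.
have class_le k : \sum_(j | k \in S (block_of n J J_cover j)) cR j 0 * x j 0 <= r.
  rewrite (eq_bigl (fun j => block_of n J J_cover j \in [set v | k \in S v]%SET));
    last by move=> j; rewrite inE.
  apply: (dissociation_le R m n A b L A_ge0 b_ge0 J J_cover J_mem _ cR x r
    e_sym nbr) xNS ub.
  by move=> v u w; rewrite !inE => kv ku kw; apply: degS ku kw.
have double_count : Delta%:R * dotv cR x =
    \sum_k \sum_(j | k \in S (block_of n J J_cover j)) cR j 0 * x j 0.
  rewrite (exchange_big_dep xpredT) //= /dotv mulr_sumr; apply: eq_bigr => j _.
  by rewrite sumr_const cardS -dE mulr_natl.
rewrite mulrAC ler_pdivlMr ?ltr0n // mulrC double_count.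
apply: (le_trans (ler_sum _ (fun k _ => class_le k))).
by rewrite sumr_const card_ord -[r *+ _]mulr_natl natrB ?natrM ?dE //; lia.
Qed.
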